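(* Let $A$ and $B$ be finite dimensional full algebras over an algebraically closed field $F$ of characteristic zero. If $A$ and $B$ are PI-equivalent (i.e. $\mathrm{Id}(A)=\mathrm{Id}(B)$), then their maximal semisimple subalgebras $A_{ss}$ and $B_{ss}$ are isomorphic. In particular this holds when $A$ and $B$ are fundamental algebras.
   Context: For a finite dimensional algebra $A$ let $A\cong A_1\times\cdots\times A_q\oplus J_A$ be its Wedderburn–Malcev decomposition, with $A_i$ simple and $J_A$ the Jacobson radical. $A$ is called full if, up to a permutation of the simple components, $A_1\cdot J_A\cdot A_2\cdots J_A\cdot A_q\neq 0$. Fundamental algebras (in the sense of Kemer's theory) are a special type of full algebras. *)

(* Defs.v *)
From HB Require Import structures.
From mathcomp Require Import all_boot all_order all_algebra.
Set Implicit Arguments. Unset Strict Implicit. Unset Printing Implicit Defensive.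
Import GRing.Theory.
Local Open Scope ring_scope.

(* Finite-dimensional associative (not necessarily unital) algebras over a
   field F, given by structure constants on F^n (row vectors). *)

Definition mulsc (F : fieldType) (n : nat) (c : 'I_n -> 'I_n -> 'rV[F]_n)
  (x y : 'rV[F]_n) : 'rV[F]_n :=
  \sum_(i < n) \sum_(j < n) (x 0 i * y 0 j) *: c i j.

Record fdalg (F : fieldType) := FdAlg {
  fdim : nat;
  fsc : 'I_fdim -> 'I_fdim -> 'rV[F]_fdim;
  fassoc : forall x y z : 'rV[F]_fdim,
      mulsc fsc (mulsc fsc x y) z = mulsc fsc x (mulsc fsc y z)
}.

Section Defs.
Variable F : fieldType.
Variable A : fdalg F.

Definition vec := 'rV[F]_(fdim A).
Definition amul (x y : vec) : vec := mulsc (@fsc F A) x y.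

(* subspaces of A are represented by row spaces of square matrices *)
Definition subsp := 'M[F]_(fdim A).

Definition is_subalg (S : subsp) : Prop :=
  forall x y : vec, (x <= S)%MS -> (y <= S)%MS -> (amul x y <= S)%MS.

Definition is_ideal_in (S I : subsp) : Prop :=
  (I <= S)%MS /\
  forall x y : vec, (x <= S)%MS -> (y <= I)%MS ->
    (amul x y <= I)%MS /\ (amul y x <= I)%MS.

Definition is_ideal (I : subsp) : Prop := is_ideal_in 1%:M I.

Definition simple_subalg (S : subsp) : Prop :=
  is_subalg S /\
  (exists x y : vec, [/\ (x <= S)%MS, (y <= S)%MS & amul x y != 0]) /\
  forall I : subsp, is_ideal_in S I -> (\rank I = 0)%N \/ (S <= I)%MS.

Definition prodl (x : vec) (xs : seq vec) : vec := foldl amul x xs.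

Definition nilpotent_sub (I : subsp) : Prop :=
  exists k : nat, forall (x : vec) (xs : seq vec), size xs = k ->
    (x <= I)%MS -> (forall y, y \in xs -> (y <= I)%MS) -> prodl x xs = 0.

Definition jacobson_radical (J : subsp) : Prop :=
  [/\ is_ideal J, nilpotent_sub J &
      forall I : subsp, is_ideal I -> nilpotent_sub I -> (I <= J)%MS].

(* Wedderburn-Malcev decomposition A = A_1 x ... x A_q (+) J_A :
   Ss = [:: A_1; ...; A_q] simple subalgebras with A_i A_j = 0 (i != j),
   and A = A_1 (+) ... (+) A_q (+) J as vector spaces (direct sum). *)
Definition WMdec (J : subsp) (Ss : seq subsp) : Prop :=
  [/\ jacobson_radical J,
      (forall S, S \in Ss -> simple_subalg S),
      (forall i j : nat, (i < size Ss)%N -> (j < size Ss)%N -> i != j ->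
         forall x y : vec, (x <= nth 0 Ss i)%MS -> (y <= nth 0 Ss j)%MS ->
           amul x y = 0),
      (\sum_(S <- Ss) \rank S + \rank J)%N = fdim A &
      ((\sum_(S <- Ss) S)%MS + J == 1%:M)%MS].

Definition ss_part (Ss : seq subsp) : subsp := (\sum_(S <- Ss) S)%MS.

Fixpoint chain_prod (J : subsp) (Ss : seq subsp) (x : vec) : Prop :=
  match Ss with
  | [::] => False
  | [:: S0] => (x <= S0)%MS
  | S0 :: Ss' => exists (a j y : vec),
      [/\ (a <= S0)%MS, (j <= J)%MS, chain_prod J Ss' y & x = amul (amul a j) y]
  end.

(* A is full: for some (equivalently any) WM decomposition, some ordering of
   the simple components A_1..A_q has A_1 J A_2 J ... J A_q != 0
   (the ordering is absorbed in the existential over the list Ss). *)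
Definition full : Prop :=
  exists (J : subsp) (Ss : seq subsp), WMdec J Ss /\
    (Ss = [::] \/ exists x : vec, chain_prod J Ss x /\ x != 0).

(* noncommutative polynomials without constant term in variables x_0,x_1,...:
   formal linear combinations of nonempty words; a word (i, w) stands for
   x_i x_(w_1) ... x_(w_k) *)
Definition ncpoly := seq (F * (nat * seq nat)).

Definition eval_word (v : nat -> vec) (w : nat * seq nat) : vec :=
  prodl (v w.1) (map v w.2).

Definition eval_ncpoly (p : ncpoly) (v : nat -> vec) : vec :=
  \sum_(t <- p) t.1 *: eval_word v t.2.

Definition is_identity (p : ncpoly) : Prop :=
  forall v : nat -> vec, eval_ncpoly p v = 0.

End Defs.

(* S (subalgebra of A) and T (subalgebra of B) are isomorphic algebras:
   a linear map F^dimA -> F^dimB which restricts to a bijection S -> T and is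
   multiplicative on S. *)
Definition subalg_iso (F : fieldType) (A B : fdalg F)
  (S : subsp A) (T : subsp B) : Prop :=
  exists f : 'M[F]_(fdim A, fdim B),
    [/\ (S *m f == T)%MS, \rank (S *m f) = \rank S &
        forall x y : vec A, (x <= S)%MS -> (y <= S)%MS ->
          amul x y *m f = amul (x *m f) (y *m f)].

(* Main.v *)
From HB Require Import structures.
From Stdlib Require Import Classical.
Require Import Defs.
From mathcomp Require Import all_boot all_order all_fingroup all_algebra all_field.
Set Implicit Arguments. Unset Strict Implicit. Unset Printing Implicit Defensive.
Import GRing.Theory.
Local Open Scope ring_scope.

(* Let A be full with simple components A_1, ..., A_q, each a matrix algebra by
   Wedderburn's theorem, and let B be arbitrary with simple components B_j and
   Id(B) contained in Id(A).  Consider the word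

     prod_i  z_i (prod_(s < m) prod_p  y_(s,p) x_(s,p) y'_(s,p)) z'_i

   where p runs over the matrix units of A_i, and alternate it, for each s
   separately, in the x_(s,p) for all matrix units p of all the A_i together.
   Since y_p e_p' y'_p vanishes for p <> p' when y_p and y'_p are suitable matrix
   units, only one monomial survives the obvious substitution in A, and fullness
   makes it nonzero.  So the polynomial is not an identity of B.  If m exceeds the
   nilpotency index of J_B, a nonzero evaluation on basis elements of B has a stage
   s without radical entries; there the x_(s,p) take distinct values in a basis of
   the semisimple part, and those belonging to the same A_i fall in the same
   B_(phi i).  Hence the dimensions of the A_i with phi i = j add up to at most
   dim B_j.  Such a relation in both directions forces phi to be a bijection
   preserving dimensions. *)

(** * Structure-constant algebras and their regular representation *)

Section Basics.
Variables (F : fieldType) (A : fdalg F).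
Local Notation d := (fdim A).
Implicit Types x y z : 'rV[F]_d.

Lemma amul_linear x : linear (@amul F A x).
Proof.
move=> a y z; rewrite /amul /mulsc scaler_sumr -big_split; apply: eq_bigr => i _ /=.
rewrite scaler_sumr -big_split; apply: eq_bigr => j _ /=.
by rewrite !mxE mulrDr scalerDl scalerA mulrCA.
Qed.

Definition amulr y x : 'rV[F]_d := @amul F A x y.

Lemma amulr_linear y : linear (amulr y).
Proof.
move=> a x z; rewrite /amulr /amul /mulsc scaler_sumr -big_split; apply: eq_bigr => i _ /=.
rewrite scaler_sumr -big_split; apply: eq_bigr => j _ /=.
by rewrite !mxE mulrDl scalerDl scalerA mulrA.
Qed.

HB.instance Definition _ x :=
  GRing.isLinear.Build F 'rV[F]_d 'rV[F]_d _ (@amul F A x) (amul_linear x).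
HB.instance Definition _ y :=
  GRing.isLinear.Build F 'rV[F]_d 'rV[F]_d _ (amulr y) (amulr_linear y).

Lemma amulA x y z : amul (amul x y) z = amul x (amul y z).
Proof. exact: fassoc. Qed.

Definition Lmx x : 'M[F]_d := lin1_mx (@amul F A x).
Definition Rmx y : 'M[F]_d := lin1_mx (amulr y).

Lemma mulLmx x y : y *m Lmx x = amul x y.
Proof. exact: mul_rV_lin1. Qed.
Lemma mulRmx x y : x *m Rmx y = amul x y.
Proof. exact: mul_rV_lin1. Qed.

(** Since row vectors are acted on from the right, right multiplication preserves the order of
    products. *)
Lemma RmxM x y : Rmx (amul x y) = Rmx x *m Rmx y.
Proof.
apply/row_matrixP=> i; rewrite !rowE mulmxA !mulRmx amulA //.
Qed.

Lemma Rmx_linear : linear Rmx.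
Proof.
move=> a x y; apply/row_matrixP=> i.
by rewrite !rowE mulmxDr -scalemxAr !mulRmx linearP.
Qed.
HB.instance Definition _ :=
  GRing.isLinear.Build F 'rV[F]_d 'M[F]_d _ Rmx Rmx_linear.

(* The regular representation of the unitization F + A. *)
Definition emb x : 'M[F]_d.+1 := block_mx (0 : 'M_1) x 0 (Rmx x).

Lemma emb_linear : linear emb.
Proof.
move=> a x y; rewrite /emb linearP.
rewrite (scale_block_mx a (0 : 'M_1) x 0 (Rmx x)) (add_block_mx _ _ _ _ (0 : 'M_1)).
by rewrite !scaler0 !addr0.
Qed.
HB.instance Definition _ :=
  GRing.isLinear.Build F 'rV[F]_d 'M[F]_d.+1 _ emb emb_linear.

Lemma embM x y : emb (amul x y) = emb x * emb y.
Proof.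
rewrite /emb RmxM; apply/esym/(etrans (mulmx_block (0 : 'M_1) x 0 _ (0 : 'M_1) y 0 _)).
by rewrite !mul0mx !mulmx0 !add0r mulRmx.
Qed.

(** The first row of [emb x] is the image of the adjoined unit, that is [x] itself, so the
    representation is faithful even if A has no unit. *)
Lemma emb_inj : injective emb.
Proof. by move=> x y /(@eq_block_mx _ 1 d 1 d) []. Qed.

Lemma emb_eq0 x : (emb x == 0) = (x == 0).
Proof. by rewrite -(inj_eq emb_inj) linear0. Qed.

Lemma emb_prodl x xs : emb (prodl x xs) = \prod_(z <- x :: xs) emb z.
Proof.
elim: xs x => [|y ys IH] x; first by rewrite big_seq1.
by rewrite /prodl /= -/(prodl _ _) IH !big_cons embM mulrA.
Qed.

Lemma amul0r x : amul 0 x = 0 :> vec A.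
Proof. exact: (linear0 (amulr x)). Qed.
Lemma amulr0 x : amul x 0 = 0 :> vec A.
Proof. exact: linear0. Qed.
Lemma amulDl x y z : amul (x + y) z = amul x z + amul y z :> vec A.
Proof. exact: (linearD (amulr z)). Qed.
Lemma amulDr x y z : amul x (y + z) = amul x y + amul x z :> vec A.
Proof. exact: linearD. Qed.

End Basics.

(** * Burnside's theorem on irreducible matrix algebras *)

Section Burnside.
Variables (F : closedFieldType) (n m : nat).

(** [C] acts on the row space of [B] through a matrix [D], which has an eigenvector over an
    algebraically closed field; the independent rows of [B] carry it to a nonzero vector. *)
Lemma eigen_restrict (k : nat) (B : 'M[F]_(k, n)) (C : 'M[F]_n) :
  (0 < k)%N -> row_free B -> (B *m C <= B)%MS ->
  exists (lam : F) (u : 'rV[F]_n), [/\ u != 0, (u <= B)%MS & u *m C = lam *: u].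
Proof.
move=> k0 fB /submxP [D eD].
have /closed_rootP [lam] : size (char_poly D) != 1.
  by rewrite size_char_poly; case: (k) k0.
rewrite -eigenvalue_root_char => /eigenvalueP [u uD u0].
exists lam, (u *m B); split; last by rewrite -mulmxA eD mulmxA uD scalemxAl.
- by apply: contra u0 => /eqP uB; rewrite -(inj_eq (row_free_inj fB)) uB mul0mx.
- exact: submxMl.
Qed.

Variable G : 'I_m -> 'M[F]_n.
(** The algebra is the span of [G]. [GM] makes it multiplicatively closed, and [Girr] is
    irreducibility in the form that every nonzero vector generates the whole space. *)
Let lc (c : 'I_m -> F) := \sum_k c k *: G k.
Hypothesis GM : forall c1 c2, exists c, lc c1 *m lc c2 = lc c.
Hypothesis Girr : forall u v : 'rV[F]_n, u != 0 -> exists c, u *m lc c = v.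

Let lcB c1 c2 a : lc (fun k => c1 k - a * c2 k) = lc c1 - a *: lc c2.
Proof.
rewrite /lc scaler_sumr -sumrB; apply: eq_bigr => k _.
by rewrite scalerBl scalerA.
Qed.

(* For lam an eigenvalue of C T on the row space of T, passing from T to
   T C T - lam T lowers the rank; choosing C to send a row of T to a vector
   whose image under T is independent of that row keeps it nonzero. *)
Lemma rank_one_exists c : lc c != 0 -> exists c', \rank (lc c') = 1%N.
Proof.
have [r] := ubnP (\rank (lc c)); elim: r c => // r IH c ler T0.
set T := lc c in ler T0.
have [r1|r1] := leqP (\rank T) 1.
  by exists c; apply/eqP; rewrite eqn_leq r1 lt0n mxrank_eq0.
have [i Ti] : exists i, row i T != 0.
  apply/existsP; apply: contraR T0; rewrite negb_exists => /forallP z.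
  by apply/eqP/row_matrixP => i; apply/eqP; rewrite row0; apply/negbNE/z.
have [j Tj] : exists j, ~~ (row j T <= row i T)%MS.
  apply/existsP; apply: contraLR r1; rewrite negb_exists -leqNgt => /forallP z.
  have /mxrankS : (T <= row i T)%MS by apply/row_subP => k; apply/negbNE/z.
  by move/leq_trans; apply; apply: rank_leq_row.
have [c1 e1] := Girr (delta_mx 0 j) Ti.
have [|lam [u [u0 uT eu]]] :=
    @eigen_restrict _ (row_base T) (lc c1 *m T) (ltnW r1) (row_base_free T).
  by rewrite eq_row_base mulmxA submxMl.
rewrite eq_row_base in uT.
have [c2 e2] := GM c1 c; have [c3 e3] := GM c c2.
have eT : lc (fun k => c3 k - lam * c k) = T *m (lc c1 *m T - lam%:M).
  by rewrite lcB -e3 -e2 mulmxBr mul_mx_scalar.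
apply: (IH (fun k => c3 k - lam * c k)).
  rewrite eT; rewrite ltnS in ler; apply: leq_trans ler.
  rewrite -(mxrank_mul_ker T (lc c1 *m T - lam%:M)) -[ltnLHS]addn0 ltn_add2l lt0n mxrank_eq0.
  apply/rowV0Pn; exists u => //; rewrite sub_capmx uT; apply/sub_kermxP.
  by rewrite mulmxBr eu mul_mx_scalar subrr.
rewrite eT; apply: contra Tj => /eqP/(congr1 (mulmx (delta_mx 0 i : 'rV_n))).
rewrite mulmx0 mulmxA -rowE mulmxBr mulmxA e1 -rowE mul_mx_scalar => /eqP.
by rewrite subr_eq0 => /eqP ->; apply: scalemx_sub.
Qed.

(** A rank-one element [cl *m rw] can be multiplied on the right to replace [rw] by any row, and on
    the left to replace [cl] by any column; the resulting products span all matrices. *)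
Lemma burnside (M : 'M[F]_n) : (0 < n)%N -> exists c, M = lc c.
Proof.
move=> n0.
have one_nz : (delta_mx 0 (Ordinal n0) : 'rV[F]_n) != 0.
  by apply/eqP => /matrixP /(_ 0 (Ordinal n0)) /eqP; rewrite !mxE !eqxx oner_eq0.
have [c0 ec0] := Girr (delta_mx 0 (Ordinal n0)) one_nz.
have /rank_one_exists [c] : lc c0 != 0.
  by apply: contra one_nz => /eqP z; rewrite -ec0 z mulmx0.
set T := lc c => T1.
have [cl [rw eT]] : exists (cl : 'cV[F]_n) (rw : 'rV[F]_n), T = cl *m rw.
  have := mulmx_base T; move: (col_base T) (row_base T).
  by rewrite T1 => cl rw e; exists cl, rw.
have rw0 : rw != 0 by apply: contra_eq_neq T1 => z; rewrite eT z mulmx0 mxrank0.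
have cl0 : cl != 0 by apply: contra_eq_neq T1 => z; rewrite eT z mul0mx mxrank0.
have lcD c1 c2 : exists c, lc c1 + lc c2 = lc c.
  exists (fun k => c1 k - (-1) * c2 k); by rewrite lcB scaleN1r opprK.
have clr (v : 'rV_n) : exists c, cl *m v = lc c.
  have [c1 <-] := Girr v rw0; have [c2 e2] := GM c c1.
  by exists c2; rewrite mulmxA -eT.
pose K : 'M[F]_(n, m) := \matrix_(i, k) (G k *m cl) i 0.
have eK (x : 'cV_m) : K *m x = lc (fun k => x k 0) *m cl.
  rewrite /lc mulmx_suml; apply/colP=> i; rewrite mxE summxE; apply: eq_bigr => k _.
  by rewrite -scalemxAl [in RHS]mxE mulrC [K _ _]mxE.
(* The columns of [K] are the images of [cl]. If [u] kills them all, then so does every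
   [u *m lc c1]; for [u] nonzero these exhaust the row vectors, forcing [cl] to vanish. *)
have fK : row_free K.
  rewrite -kermx_eq0; apply/rowV0P => u /sub_kermxP uK; apply/eqP.
  apply: contraR cl0 => u0; apply/eqP/colP => i; rewrite mxE.
  have [c1 e1] := Girr (delta_mx 0 i) u0.
  have : (u *m (K *m \col_k c1 k)) 0 0 = 0 by rewrite mulmxA uK mul0mx mxE.
  rewrite eK mulmxA (_ : lc _ = lc c1) ?e1 -?rowE ?mxE //.
  by apply: eq_bigr => k _; rewrite mxE.
have [X KX] := row_freeP fK.
have allr (i : 'I_n) (v : 'rV_n) : exists c, delta_mx i (0 : 'I_1) *m v = lc c.
  have -> : delta_mx i (0 : 'I_1) = K *m (X *m delta_mx i 0) by rewrite mulmxA KX mul1mx.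
  rewrite eK -mulmxA; have [c1 ->] := clr v.
  have [c2 e2] := GM (fun k => (X *m delta_mx i (0 : 'I_1)) k 0) c1.
  by exists c2.
have -> : M = \sum_i delta_mx i (0 : 'I_1) *m row i M.
  apply/matrixP => i j; rewrite summxE (bigD1 i) //= big1 ?addr0 => [|k ki].
    by rewrite mxE big_ord1 !mxE !eqxx mul1r.
  by rewrite mxE big_ord1 !mxE eq_sym (negPf ki) mul0r.
apply: (big_ind (fun M => exists c, M = lc c)).
- by exists (fun=> 0); rewrite /lc big1 // => k _; rewrite scale0r.
- by move=> _ _ [c1 ->] [c2 ->]; have [c3 e3] := lcD c1 c2; exists c3.
- by move=> i _; apply: allr.
Qed.

End Burnside.

(** * Wedderburn's theorem *)

Section Annihilators.
Variables (F : fieldType) (A : fdalg F).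
Local Notation d := (fdim A).
Implicit Types (x y z : vec A) (S T : subsp A).

(** By linearity it is enough to annihilate the rows spanning [T]. *)
Definition annl T : subsp A := (\bigcap_i kermx (Rmx (row i T)))%MS.
Definition annr T : subsp A := (\bigcap_i kermx (Lmx (row i T)))%MS.

Lemma annlP T x : (x <= annl T)%MS <-> forall y, (y <= T)%MS -> amul x y = 0.
Proof.
split=> [/sub_bigcapmxP xT y /submxP [D ->] | xT].
  suff TL : T *m Lmx x = 0 by rewrite -mulLmx -mulmxA TL mulmx0.
  apply/row_matrixP => i; rewrite row_mul mulLmx row0 -mulRmx.
  exact/sub_kermxP/xT.
by apply/sub_bigcapmxP => i _; apply/sub_kermxP; rewrite mulRmx xT ?row_sub.
Qed.

Lemma annrP T x : (x <= annr T)%MS <-> forall y, (y <= T)%MS -> amul y x = 0.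
Proof.
split=> [/sub_bigcapmxP xT y /submxP [D ->] | xT].
  suff TL : T *m Rmx x = 0 by rewrite -mulRmx -mulmxA TL mulmx0.
  apply/row_matrixP => i; rewrite row_mul mulRmx row0 -mulLmx.
  exact/sub_kermxP/xT.
by apply/sub_bigcapmxP => i _; apply/sub_kermxP; rewrite mulLmx xT ?row_sub.
Qed.

Definition right_ideal S (L : subsp A) := (L <= S)%MS /\
  forall x y, (x <= L)%MS -> (y <= S)%MS -> (amul x y <= L)%MS.

(** The elements of [S] with this property form a two-sided ideal, which is proper because [S] has a
    nonzero product. This does duty for a unit in [S]. *)
Lemma simple_annl0 S x : simple_subalg S -> (x <= S)%MS ->
  (forall y, (y <= S)%MS -> amul x y = 0) -> x = 0.
Proof.
move=> [Sal [[a [b [aS bS ab]]] Ssi]] xS xann.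
have Kid : is_ideal_in S (S :&: annl S)%MS.
  split; first exact: capmxSl.
  move=> y z yS; rewrite !sub_capmx => /andP [zS /annlP zA].
  split; apply/andP; split; try exact: Sal.
    by apply/annlP => t tS; rewrite amulA zA ?amulr0.
  by apply/annlP => t tS; rewrite amulA zA //; apply: Sal.
have xK : (x <= S :&: annl S)%MS by rewrite sub_capmx xS; apply/annlP.
case: (Ssi _ Kid) => [/eqP|SK].
  by rewrite mxrank_eq0 => /eqP K0; move: xK; rewrite K0 submx0 => /eqP.
have /annlP ann : (a <= annl S)%MS by apply: submx_trans (submx_trans aS SK) (capmxSr _ _).
by rewrite ann ?eqxx in ab.
Qed.

Lemma minimal_right_ideal S : S != 0 -> is_subalg S -> exists L : subsp A,
  [/\ L != 0, right_ideal S L &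
      forall L', right_ideal S L' -> (L' <= L)%MS -> L' != 0 -> (L <= L')%MS].
Proof.
move=> S0 Sal.
have : exists L : subsp A, L != 0 /\ right_ideal S L.
  by exists S.
case=> L; have [r] := ubnP (\rank L); elim: r L => // r IH L rL [L0 Li].
have [[L' [L'i L'L L'0 nLL']]|nex] := classic (exists L' : subsp A,
   [/\ right_ideal S L', (L' <= L)%MS, L' != 0 & ~~ (L <= L')%MS]).
  apply: (IH L') => //; rewrite ltnS in rL; apply: leq_trans rL.
  by apply: rank_ltmx; rewrite ltmxE L'L.
exists L; split => // L' L'i L'L L'0; apply/negP => /negP nLL'.
by apply: nex; exists L'.
Qed.

End Annihilators.

Section Wedderburn.
Variables (F : closedFieldType) (A : fdalg F).
Local Notation d := (fdim A).
Implicit Types (x y z : vec A) (S T : subsp A).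

(** [S] acts by right multiplication on a minimal right ideal [L], faithfully by simplicity and
    irreducibly by minimality, so Burnside's theorem makes the action onto all matrices. The
    isomorphism from matrices to [S] is [X] to [mxvec X *m g]. *)
Lemma wedderburn S : simple_subalg S ->
  exists n (g : 'M[F]_(n.+1 * n.+1, d)), [/\ row_free g, (g == S)%MS &
    forall X Y : 'M_n.+1,
      amul (mxvec X *m g : vec A) (mxvec Y *m g) = mxvec (X *m Y) *m g].
Proof.
move=> Ssimp; have [Sal [[a [b [aS bS ab]]] Ssi]] := Ssimp.
have S0 : S != 0.
  apply: contra ab => /eqP z; move: aS; rewrite z submx0 => /eqP ->.
  by rewrite amul0r.
have [L [L0 [LS Lr] Lmin]] := minimal_right_ideal S0 Sal.
suff [n [n0 [g gP]]] : exists n, (0 < n)%N /\ exists g : 'M[F]_(n * n, d),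
    [/\ row_free g, (g == S)%MS & forall X Y : 'M_n,
      amul (mxvec X *m g : vec A) (mxvec Y *m g) = mxvec (X *m Y) *m g].
  by case: n n0 g gP => // n _ g gP; exists n, g.
set n := \rank L; exists n; split; first by rewrite lt0n mxrank_eq0.
pose U : 'M[F]_(n, d) := row_base L.
have fU : row_free U by apply: row_base_free.
(* The matrix of right multiplication by [x] on [L] in the basis [U]. *)
pose rho (x : 'rV[F]_d) : 'M[F]_n := U *m Rmx (x : vec A) *m pinvmx U.
have rhoU x : (x <= S)%MS -> rho x *m U = U *m Rmx x.
  move=> xS; apply: mulmxKpV; apply/row_subP => i.
  rewrite row_mul mulRmx eq_row_base; apply: Lr => //.
  by apply: submx_trans (row_sub _ _) _; rewrite eq_row_base.
have UL (u : 'rV_n) : (u *m U <= L)%MS.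
  by apply: submx_trans (submxMl _ _) _; rewrite eq_row_base.
have rhoM x y : (x <= S)%MS -> (y <= S)%MS -> rho (amul x y) = rho x *m rho y.
  by move=> xS yS; rewrite [in LHS]/rho RmxM (mulmxA U) -rhoU // -!(mulmxA (rho x)).
have rho_inj x : (x <= S)%MS -> rho x = 0 -> x = 0.
  move=> xS rx0.
  have Kid : is_ideal_in S (S :&: annr L)%MS.
    split; first exact: capmxSl.
    move=> y z yS; rewrite !sub_capmx => /andP [zS /annrP zA].
    split; apply/andP; split; try exact: Sal.
      by apply/annrP => t tS; rewrite -amulA zA ?Lr.
    by apply/annrP => t tS; rewrite -amulA zA // amul0r.
  have xK : (x <= S :&: annr L)%MS.
    rewrite sub_capmx xS; apply/annrP => y yL.
    have /submxP [D ->] : (y <= U)%MS by rewrite eq_row_base.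
    by rewrite -mulRmx -mulmxA -rhoU // rx0 mul0mx mulmx0.
  case: (Ssi _ Kid) => [/eqP|SK].
    by rewrite mxrank_eq0 => /eqP K0; move: xK; rewrite K0 submx0 => /eqP.
  (* If the kernel were all of [S], a nonzero row of [L] would annihilate [S] from the left. *)
  have [i Li] : exists i, row i L != 0.
    apply/existsP; apply: contraR L0; rewrite negb_exists => /forallP z.
    by apply/eqP/row_matrixP => i; apply/eqP; rewrite row0; apply/negbNE/z.
  case/eqP: Li; apply: (simple_annl0 Ssimp).
    by apply: submx_trans (row_sub _ _) LS.
  move=> y yS; have /annrP -> // : (y <= annr L)%MS.
    by apply: submx_trans (submx_trans yS SK) (capmxSr _ _).
  exact: row_sub.
pose Rho : 'M[F]_(d, n * n) :=
  lin1_mx (mxvec \o (mulmxr (pinvmx U) \o (mulmx U \o @Rmx F A))).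
have RhoE x : x *m Rho = mxvec (rho x) by rewrite mul_rV_lin1.
pose G k := rho (row k S).
have lcE (c : 'I_d -> F) : \sum_k c k *: G k = rho ((\row_k c k) *m S).
  apply: (can_inj mxvecK); rewrite -RhoE (mulmx_sum_row _ S) mulmx_suml linear_sum.
  by apply: eq_bigr => k _; rewrite linearZ -scalemxAl RhoE !mxE.
have sur (M : 'M_n) : exists D : 'rV_d, M = rho (D *m S).
  have [| | |c ->] := @burnside F n d G _ _ M; last by exists (\row_k c k).
  - move=> c1 c2; rewrite !lcE -rhoM ?submxMl //.
    have /submxP [D ->] := Sal _ _ (submxMl (\row_k c1 k) S) (submxMl (\row_k c2 k) S).
    by exists (D 0); rewrite lcE; congr (rho (_ *m _)); apply/rowP=> k; rewrite mxE.
  - move=> u v u0; set l := u *m U.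
    have l0 : l != 0.
      by apply: contra u0 => /eqP z; rewrite -(inj_eq (row_free_inj fU)) -/l z mul0mx.
    have lL : (l <= L)%MS by apply: UL.
    (* The right ideal [l S] is contained in [L] and nonzero, so it equals [L]: this is
       irreducibility. *)
    have : (L <= S *m Lmx l)%MS.
      apply: Lmin.
      + split.
          apply/row_subP => i; rewrite row_mul mulLmx.
          by apply: (submx_trans _ LS); apply: Lr => //; apply: row_sub.
        move=> x y /submxP [D ->] yS; rewrite mulmxA mulLmx amulA -mulLmx submxMr //.
        by apply: Sal => //; apply: submxMl.
      + by apply/row_subP => i; rewrite row_mul mulLmx; apply: Lr => //; apply: row_sub.
      + apply: contra l0 => /eqP z; apply/eqP/(simple_annl0 Ssimp).
          exact: submx_trans lL LS.
        by move=> y /submxP [D ->]; rewrite -mulLmx -mulmxA z mulmx0.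
    move/(submx_trans (UL v)) => /submxP [D eD]; exists (D 0).
    apply: (row_free_inj fU); rewrite /= eD lcE -(mulmxA u) rhoU ?submxMl //.
    rewrite (mulmxA u) (mulRmx l) (mulmxA D) mulLmx.
    by congr (amul _ (_ *m _)); apply/rowP => k; rewrite mxE.
  - by rewrite lt0n mxrank_eq0.
have full : row_full (S *m Rho).
  rewrite -sub1mx; apply/row_subP => i.
  have [D] := sur (vec_mx (row i 1%:M)); move/(congr1 mxvec).
  by rewrite vec_mxK -RhoE -mulmxA => ->; apply: submxMl.
(* A linear section of [rho] with values in [S]; injectivity of [rho] on [S] makes it a two-sided
   inverse. *)
pose g := pinvmx (S *m Rho) *m S; exists g.
have gRho : g *m Rho = 1%:M by rewrite -mulmxA mulVpmx.
have gS : (g <= S)%MS by apply: submxMl.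
have rhog X : rho (mxvec X *m g) = X.
  by apply: (can_inj mxvecK); rewrite -RhoE -mulmxA gRho mulmx1.
have inS X : (mxvec X *m g <= S)%MS by apply: submx_trans (submxMl _ _) gS.
have rinj x y : (x <= S)%MS -> (y <= S)%MS -> rho x = rho y -> x = y.
  move=> xS yS e; apply/eqP; rewrite -subr_eq0; apply/eqP/rho_inj.
    by rewrite addmx_sub // eqmx_opp.
  by apply: (can_inj mxvecK); rewrite -RhoE mulmxBl !RhoE e subrr linear0.
split.
- by apply/row_freeP; exists Rho.
- apply/andP; split => //; apply/row_subP => i.
  have -> : row i S = mxvec (rho (row i S)) *m g.
    by apply: rinj; rewrite ?row_sub ?inS ?rhog.
  exact: submxMl.
- move=> X Y; apply: rinj; [exact: Sal | exact: inS |].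
  by rewrite rhoM ?inS // !rhog.
Qed.
End Wedderburn.

(** * Comparison of Wedderburn-Malcev decompositions *)

Section Dominance.

(** Items of sizes [a] are packed by [phi] into bins of capacities [b]. *)
Definition dominated (q r : nat) (a : 'I_q -> nat) (b : 'I_r -> nat) :=
  exists phi : 'I_q -> 'I_r, forall j, (\sum_(i | phi i == j) a i <= b j)%N.

Lemma dominated_trans q r s (a : 'I_q -> nat) (b : 'I_r -> nat) (c : 'I_s -> nat) :
  dominated a b -> dominated b c -> dominated a c.
Proof.
move=> [phi ab] [psi bc]; exists (psi \o phi) => k; apply: leq_trans (bc k).
rewrite (partition_big phi (fun j => psi j == k)) //=; apply: leq_sum => j /eqP jk.
apply: leq_trans (ab j); rewrite (eq_bigl (fun i => phi i == j)) // => i.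
by case: (phi i =P j) => [->|]; rewrite ?jk ?eqxx ?andbF.
Qed.

Lemma dominated_sum q r (a : 'I_q -> nat) (b : 'I_r -> nat) (phi : 'I_q -> 'I_r) :
  (forall j, (\sum_(i | phi i == j) a i <= b j)%N) -> (\sum_i a i <= \sum_j b j)%N.
Proof.
by move=> ab; rewrite (partition_big phi predT) //=; apply: leq_sum => j _; apply: ab.
Qed.

(** When the total capacity does not exceed the total size, every bin is filled exactly; a bin of
    positive capacity is then nonempty, and [h] picks an item in it. *)
Lemma dominated_card q r (a : 'I_q -> nat) (b : 'I_r -> nat) (phi : 'I_q -> 'I_r) :
  (forall j, (0 < b j)%N) -> (\sum_j b j <= \sum_i a i)%N ->
  (forall j, (\sum_(i | phi i == j) a i <= b j)%N) ->
  (forall j, (\sum_(i | phi i == j) a i)%N = b j) /\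
  exists2 h : 'I_r -> 'I_q, cancel h phi & injective h.
Proof.
move=> b0 ba ab.
have sumE : (\sum_i a i = \sum_j \sum_(i | phi i == j) a i)%N.
  exact: (partition_big phi predT).
have eqs j : (\sum_(i | phi i == j) a i)%N = b j.
  have /leqif_sum [_] : forall j, true ->
    (\sum_(i | phi i == j) a i <= b j ?= iff (\sum_(i | phi i == j) a i == b j))%N.
    by move=> k _; apply: leqif_eq.
  rewrite -sumE eqn_leq (dominated_sum ab) ba /=.
  by move/esym/forallP/(_ j)/eqP.
have [h hK] : exists h : 'I_r -> 'I_q, forall j, phi (h j) = j.
  apply: (@fin_all_exists _ (fun=> 'I_q) (fun j i => phi i = j)) => j.
  suff /existsP [i /eqP ij] : [exists i, phi i == j] by exists i.
  have := b0 j; apply: contraTT; rewrite negb_exists => /forallP n.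
  by rewrite -eqs big1 // => i /eqP ij; have := n i; rewrite ij eqxx.
by split=> //; exists h => //; apply: can_inj hK.
Qed.

(** Packings in both directions make the totals equal and both maps onto, so there are as many bins
    as items and each exactly filled bin holds one item. *)
Lemma dominated_antisym q r (a : 'I_q -> nat) (b : 'I_r -> nat) :
  (forall i, (0 < a i)%N) -> (forall j, (0 < b j)%N) ->
  dominated a b -> dominated b a ->
  exists2 phi : 'I_q -> 'I_r, bijective phi & forall i, a i = b (phi i).
Proof.
move=> a0 b0 [phi ab] [psi ba].
have [eqs [h hK hI]] := dominated_card b0 (dominated_sum ba) ab.
have [_ [k kK kI]] := dominated_card a0 (dominated_sum ab) ba.
have hb : bijective h by apply: inj_card_bij => //; apply: leq_card kI.
have phib : bijective phi by apply: bij_can_bij hK.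
exists phi => // i; rewrite -eqs (big_pred1 i) // => i'.
by rewrite (inj_eq (bij_inj phib)).
Qed.

End Dominance.

(** * Dimensions and ideals in a Wedderburn-Malcev decomposition *)

Section WedderburnMalcev.
Variables (F : fieldType) (A : fdalg F).
Local Notation d := (fdim A).
Implicit Types (x y z : vec A) (S T J : subsp A) (Ss : seq (subsp A)).

Lemma mxrank_sum_leq (I : Type) (r : seq I) (P : pred I) (M : I -> 'M[F]_d) :
  (\rank (\sum_(i <- r | P i) M i)%MS <= \sum_(i <- r | P i) \rank (M i))%N.
Proof.
elim: r => [|i r IH]; first by rewrite !big_nil mxrank0.
rewrite !big_cons; case: ifP => // _.
exact: leq_trans (mxrank_adds_leqif _ _) (leq_add _ _).
Qed.

Section Decomposition.
Variables (J : subsp A) (Ss : seq (subsp A)).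
Hypothesis dec : WMdec J Ss.
Local Notation q := (size Ss).
Local Notation S i := (nth 0 Ss (nat_of_ord i) : subsp A).

Lemma WM_simple (i : 'I_q) : simple_subalg (S i).
Proof. by case: dec => _ H _ _ _; apply: H; apply: mem_nth. Qed.

Lemma simple_rank_gt0 T : simple_subalg T -> (0 < \rank T)%N.
Proof.
move=> [_ [[x [y [xT _ xy]]] _]]; rewrite lt0n mxrank_eq0.
by apply: contra xy => /eqP z; move: xT; rewrite z submx0 => /eqP ->; rewrite amul0r.
Qed.

Lemma WM_orth (i j : 'I_q) x y : i != j -> (x <= S i)%MS -> (y <= S j)%MS ->
  amul x y = 0.
Proof. by case: dec => _ _ H _ _ ij; apply: H. Qed.

Lemma WM_sumE : (\sum_(T <- Ss) T)%MS = (\sum_(i < q) S i)%MS.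
Proof. by rewrite (big_nth 0) big_mkord. Qed.

(** Ranks are subadditive, and a loss in a partial sum would prevent the whole sum from reaching
    [fdim A]. *)
Lemma WM_rank (K : pred 'I_q) :
  \rank ((\sum_(i | K i) S i)%MS + J)%MS = (\sum_(i | K i) \rank (S i) + \rank J)%N.
Proof.
case: dec => _ _ _ rk full; apply/eqP; rewrite eqn_leq; apply/andP; split.
  apply: leq_trans (mxrank_adds_leqif _ _) _; rewrite leq_add2r.
  exact: mxrank_sum_leq.
rewrite -(leq_add2l (\sum_(i | ~~ K i) \rank (S i))) addnA.
have -> : (\sum_(i | ~~ K i) \rank (S i) + \sum_(i | K i) \rank (S i))%N
    = (\sum_(T <- Ss) \rank T)%N.
  by rewrite (big_nth 0) big_mkord [RHS](bigID K) /= addnC.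
rewrite rk.
have: (1%:M <= (\sum_(i | ~~ K i) S i)%MS + ((\sum_(i | K i) S i)%MS + J))%MS.
  rewrite addsmxA; case/andP: full => _ /submx_trans; apply.
  by rewrite addsmxS // WM_sumE [X in (X <= _)%MS](bigID K) /= addsmxC.
move/mxrankS; rewrite mxrank1 => /leq_trans; apply.
apply: leq_trans (mxrank_adds_leqif _ _) _; rewrite leq_add2r.
exact: mxrank_sum_leq.
Qed.

Lemma WM_rank1 (i : 'I_q) : \rank (S i + J)%MS = (\rank (S i) + \rank J)%N.
Proof. by have := WM_rank (pred1 i); rewrite !big_pred1_eq. Qed.

Lemma WM_capJ (i : 'I_q) : (S i :&: J)%MS = 0.
Proof.
apply/eqP; rewrite -mxrank_eq0 -(eqn_add2l (\rank (S i + J)%MS)) mxrank_sum_cap.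
by rewrite WM_rank1 addn0.
Qed.

Lemma WM_decomp x : exists (u : 'I_q -> 'rV[F]_d) (t : vec A),
  [/\ x = \sum_i u i + t, forall i, (u i <= S i)%MS & (t <= J)%MS].
Proof.
case: dec => _ _ _ _ /andP [_ full].
have /sub_addsmxP [[u v] /= ->] : (x <= (\sum_(T <- Ss) T)%MS + J)%MS.
  exact: submx_trans (submx1 _) full.
have /sub_sumsmxP [w ->] : (u *m (\sum_(T <- Ss) T)%MS <= \sum_(i < q) S i)%MS.
  by rewrite -WM_sumE submxMl.
by exists (fun i => w i *m S i), (v *m J); split=> // [i|]; apply: submxMl.
Qed.

Lemma WM_idealJ x y : (y <= J)%MS -> (amul x y <= J)%MS /\ (amul y x <= J)%MS.
Proof. by case: dec => [[[_ JI] _ _]] _ _ _ _; apply: JI; rewrite submx1. Qed.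

(** Components other than [S i] multiply it to zero, and every product with a radical factor falls
    in [J]. *)
Lemma WM_ideal (i : 'I_q) x y : (y <= S i + J)%MS ->
  (amul x y <= S i + J)%MS /\ (amul y x <= S i + J)%MS.
Proof.
have [Sal _] := WM_simple i.
have JS z : (z <= J)%MS -> (z <= S i + J)%MS by move/submx_trans; apply; apply: addsmxSr.
case/sub_addsmxP => [[s t] /= ->]; have [u [v [-> uS vJ]]] := WM_decomp x.
have sS := submxMl s (S i); have tJ := submxMl t J.
rewrite !amulDl !amulDr; split; repeat (apply: addmx_sub).
- rewrite -/(amulr _ _) linear_sum summx_sub // => k _; rewrite /= /amulr.
  have [->|ki] := eqVneq k i; last by rewrite (WM_orth ki) ?sub0mx.
  by apply: submx_trans (Sal _ _ _ _) (addsmxSl _ _).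
- by apply: JS; case: (WM_idealJ (\sum_i u i) tJ).
- by apply: JS; case: (WM_idealJ (s *m S i) vJ).
- by apply: JS; case: (WM_idealJ v tJ).
- rewrite linear_sum summx_sub // => k _ /=.
  have [->|ki] := eqVneq k i; last by rewrite (@WM_orth i k) ?sub0mx // eq_sym.
  by apply: submx_trans (Sal _ _ _ _) (addsmxSl _ _).
- by apply: JS; case: (WM_idealJ (s *m S i) vJ).
- by apply: JS; case: (WM_idealJ (\sum_i u i) tJ).
- by apply: JS; case: (WM_idealJ v tJ).
Qed.

End Decomposition.

(** Fullness provides some decomposition while the theorem speaks of any, so two decompositions of
    one algebra must be compared. Each component of the first lies in some ideal [nth 0 Ss' i + J']:
    otherwise, by simplicity, it meets all of them trivially, which makes its products radical and
    hence zero. *)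
Lemma WM_dominated J Ss J' Ss' : WMdec J Ss -> WMdec J' Ss' ->
  dominated (fun i : 'I_(size Ss) => \rank (nth 0 Ss i))
            (fun i : 'I_(size Ss') => \rank (nth 0 Ss' i)).
Proof.
move=> dec dec'.
have JJ' : (J <= J')%MS by case: dec' dec => [[_ _ m] _ _ _ _] [[Ji Jn _] _ _ _ _]; apply: m.
have J'J : (J' <= J)%MS by case: dec dec' => [[_ _ m] _ _ _ _] [[Ji Jn _] _ _ _ _]; apply: m.
have ex (j : 'I_(size Ss)) : exists i : 'I_(size Ss'), (nth 0 Ss j <= nth 0 Ss' i + J')%MS.
  apply/existsP; apply: contraT; rewrite negb_exists => /forallP no.
  set S := nth 0 Ss j in no.
  have [Sal [[a [b [aS bS /eqP ab]]] Ssi]] := WM_simple dec j; rewrite -/S in Sal aS bS Ssi.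
  have cap0 i : (S :&: (nth 0 Ss' (i : 'I_(size Ss')) + J'))%MS = 0.
    have Kid : is_ideal_in S (S :&: (nth 0 Ss' i + J'))%MS.
      split; first exact: capmxSl.
      move=> x y xS; rewrite !sub_capmx => /andP [yS yK].
      by have [-> ->] := WM_ideal dec' x yK; rewrite !Sal.
    case: (Ssi _ Kid) => [/eqP|SK]; first by rewrite mxrank_eq0 => /eqP.
    by have := no i; rewrite (submx_trans SK (capmxSr _ _)).
  (* The product lies in both ideals [S + J] and [nth 0 Ss' i + J']; its [S]-part is therefore in
     the intersection [cap0], which is zero. *)
  have SJ s i : (s <= nth 0 Ss' (i : 'I_(size Ss')))%MS -> (amul a s <= J)%MS.
    move=> sS'.
    have : (amul a s <= nth 0 Ss' i + J')%MS.
      by case: (WM_ideal dec' a (submx_trans sS' (addsmxSl _ J'))).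
    have : (amul a s <= S + J)%MS.
      by case: (WM_ideal dec s (submx_trans aS (addsmxSl _ J))).
    case/sub_addsmxP => [[u v] /= ->] uv.
    have vJ : (v *m J <= J)%MS := submxMl _ _.
    suff /eqP -> : u *m S == 0 by rewrite add0r.
    rewrite -submx0 -(cap0 i) sub_capmx submxMl /=.
    rewrite -[u *m S](addrK (v *m J)) addmx_sub // eqmx_opp.
    exact: submx_trans vJ (submx_trans JJ' (addsmxSr _ _)).
  exfalso; apply: ab; apply/eqP; rewrite -submx0 -(WM_capJ dec j) sub_capmx -/S Sal //=.
  have [u [t [-> uS tJ]]] := WM_decomp dec' b.
  rewrite amulDr addmx_sub //; last by case: (WM_idealJ dec a (submx_trans tJ J'J)).
  by rewrite linear_sum summx_sub // => i _; apply: (SJ _ i).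
have [phi phiP] := fin_all_exists ex; exists phi => i.
rewrite -(leq_add2r (\rank J)) -(WM_rank dec).
have -> : \rank J = \rank J' by apply/eqP; rewrite eqn_leq !mxrankS.
rewrite -(WM_rank1 dec' i); apply: mxrankS; rewrite addsmx_sub; apply/andP; split.
  by apply/sumsmx_subP => j /eqP <-.
exact: submx_trans JJ' (addsmxSr _ _).
Qed.

End WedderburnMalcev.

(** * Alternating polynomials *)

Section Products.
Variable R : nzRingType.

Lemma prod_seq_neq0 (T : eqType) (r : seq T) (P : pred T) (f : T -> R) x :
  \prod_(i <- r | P i) f i != 0 -> x \in r -> P x -> f x != 0.
Proof.
move=> nz /splitPr r_eq; case: r_eq nz => r1 r2.
rewrite big_cat big_cons /= => nz Px; rewrite Px in nz; apply: contra nz => /eqP ->.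
by rewrite mul0r mulr0.
Qed.

Lemma prod_absorb (T : Type) (r : seq T) (P : pred T) (f : T -> R) e :
  (forall i, P i -> e * f i = e) -> e * \prod_(i <- r | P i) f i = e.
Proof.
move=> ef; elim: r => [|i r IH]; first by rewrite big_nil mulr1.
by rewrite big_cons; case: ifP => // Pi; rewrite mulrA ef.
Qed.

(** Adjacent factors of a nonzero product have nonzero product, so the value of [k] propagates along
    the list. *)
Lemma prod_neq0_const (T : eqType) (K : Type) (r : seq T) (f : T -> R) (k : T -> K) :
  (forall a b, a \in r -> b \in r -> f a * f b != 0 -> k a = k b) ->
  \prod_(a <- r) f a != 0 -> forall a b, a \in r -> b \in r -> k a = k b.
Proof.
case: r => // x r fk nz.
suff kx a : a \in x :: r -> k a = k x by move=> a b /kx -> /kx ->.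
elim: r x fk nz a => [|y r IH] x fk nz a; first by rewrite inE => /eqP ->.
have xy : k x = k y.
  apply: fk; rewrite ?inE ?eqxx ?orbT //.
  by move: nz; rewrite !big_cons mulrA; apply: contraNneq => ->; rewrite mul0r.
rewrite inE => /predU1P [-> //|ar]; rewrite xy; apply: IH => //.
  by move=> b c br cr; apply: fk; rewrite inE ?br ?cr orbT.
by move: nz; rewrite big_cons; apply: contraNneq => ->; rewrite mulr0.
Qed.

End Products.

Section Nilpotent.
Variables (F : fieldType) (A : fdalg F) (J : subsp A).
Hypothesis Jid : is_ideal J.

(* Each factor in the ideal absorbs its neighbours outside it. *)
Lemma prod_ideal_collect k (r : seq (vec A)) : (k < count (fun x => x <= J)%MS r)%N ->
  exists x xs, [/\ size xs = k, (x <= J)%MS, forall y, y \in xs -> (y <= J)%MS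
    & \prod_(z <- r) emb z = emb (prodl x xs)].
Proof.
have Jl x y : (y <= J)%MS -> (amul x y <= J)%MS.
  by case: Jid => _ H yJ; have [] := H x y (submx1 _) yJ.
have Jr x y : (y <= J)%MS -> (amul y x <= J)%MS.
  by case: Jid => _ H yJ; have [] := H x y (submx1 _) yJ.
elim: r k => [//|y r IH] k /=; case: (boolP (y <= J)%MS) => yJ /=.
  case: k => [_|k]; last first.
    rewrite add1n ltnS => /IH [x [xs [sz xJ xsJ e]]]; exists y, (x :: xs).
    split=> //; [by rewrite /= sz | | by rewrite big_cons e !emb_prodl !big_cons].
    by move=> z; rewrite inE => /predU1P [-> //|]; apply: xsJ.
  (* A single ideal element is wanted here, and [y] absorbs the whole tail. *)
  exists (prodl y r), [::]; split=> //; last by rewrite emb_prodl big_seq1 emb_prodl.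
  by elim: r {IH} y yJ => //= z r IH y yJ; apply: IH; apply: Jr.
rewrite add0n => /IH [x [xs [sz xJ xsJ e]]]; exists (amul y x), xs; split=> //.
  exact: Jl.
by rewrite big_cons e !emb_prodl !big_cons embM mulrA.
Qed.

End Nilpotent.

(** * Monomials alternated within classes of variables *)

Section Alternation.
Variables (F : fieldType) (V : finType) (L : eqType) (lab : V -> L) (w : seq V).

Definition preserves (s : {perm V}) := [forall a, lab (s a) == lab a].

(** The sum runs over the product of the symmetric groups of the label classes. Values are taken
    through [emb], in a ring with unit, so that iterated products are available. *)
Definition alt (A : fdalg F) (u : V -> vec A) : 'M[F]_((fdim A).+1) :=
  \sum_(s : {perm V} | preserves s) (-1) ^+ s *: \prod_(a <- w) emb (u (s a)).

(** Numbering the variables by [pickle] gives one polynomial serving all algebras, which is what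
    lets a non-identity pass from A to B. Its words must be nonempty, as there is no constant
    term. *)
Lemma alt_ncpoly : w != [::] ->
  exists p : ncpoly F, forall A, is_identity A p <-> forall u : V -> vec A, alt u = 0.
Proof.
case ew: w => [//|a0 w'] _.
pose code (s : {perm V}) : F * (nat * seq nat) :=
  ((-1) ^+ s, (pickle (s a0), [seq pickle (s a) | a <- w'])).
exists [seq code s | s <- index_enum {perm V} & preserves s] => A.
have ev (v : nat -> vec A) :
    emb (eval_ncpoly [seq code s | s <- index_enum {perm V} & preserves s] v)
    = alt (fun a => v (pickle a)).
  rewrite /eval_ncpoly linear_sum /= big_map big_filter; apply: eq_bigr => s _.
  by rewrite linearZ /= /eval_word emb_prodl ew !big_cons /= !big_map.
split=> [idp u | altp v]; last by apply: emb_inj; rewrite ev altp linear0.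
have := ev (fun n => if unpickle n is Some a then u a else 0).
rewrite idp linear0 => e; rewrite [RHS]e; apply: eq_bigr => s _; congr (_ *: _).
by apply: eq_bigr => a _; rewrite pickleK.
Qed.

(** Composing with the transposition of [a] and [b] changes every sign and no value, so the sum is
    its own opposite. *)
Lemma alt_eq0 (A : fdalg F) (u : V -> vec A) a b : (2%:R : F) != 0 ->
  a != b -> lab a = lab b -> u a = u b -> alt u = 0.
Proof.
move=> two ab lab_ab uab; set t := tperm a b.
have tu x : u (t x) = u x by rewrite /t; case: tpermP => // ->.
have tl x : lab (t x) = lab x by rewrite /t; case: tpermP => // ->.
have : alt u = - alt u.
  rewrite {1}/alt (reindex_inj (mulIg t)) -sumrN; apply: eq_big => s.
    by apply: eq_forallb => x; rewrite permM tl.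
  move=> _; rewrite odd_permM odd_tperm ab addbT signrN scaleNr; congr (- (_ *: _)).
  by apply: eq_bigr => x _; rewrite permM tu.
move/eqP; rewrite -subr_eq0 opprK -mulr2n -scaler_nat scaler_eq0 (negPf two).
by move/eqP.
Qed.

Section Multilinear.
Variables (A : fdalg F) (I : finType) (bas : I -> vec A).
Hypotheses (w_uniq : uniq w) (w_all : forall a, a \in w).
Hypothesis bas_span : forall x : vec A, exists c : I -> F, x = \sum_i c i *: bas i.

Definition update (u : V -> vec A) a x b := if b == a then x else u b.

Lemma alt_update (u : V -> vec A) a (c : I -> F) : u a = \sum_i c i *: bas i ->
  alt u = \sum_i c i *: alt (update u a (bas i)).
Proof.
move=> ua; under [RHS]eq_bigr => i _ do rewrite /alt scaler_sumr.
rewrite exchange_big; apply: eq_bigr => s _ /=.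
under [RHS]eq_bigr => i _ do rewrite scalerA mulrC -scalerA.
rewrite -scaler_sumr; congr (_ *: _).
rewrite -(big_map s predT (fun b => emb (u b))).
under [RHS]eq_bigr => i _ do
  rewrite -(big_map s predT (fun b => emb (update u a (bas i) b))).
(* The variable [a] occurs exactly once in each permuted word, so the monomial is linear in its
   value. *)
have a_in : a \in map s w by apply/mapP; exists ((s^-1)%g a); rewrite ?permKV.
have : uniq (map s w) by rewrite map_inj_uniq //; apply: perm_inj.
case/splitPr: a_in => r1 r2; rewrite cat_uniq /= negb_or => /and3P[_ /andP[a1 _] /andP[a2 _]].
rewrite big_cat big_cons /= ua linear_sum mulr_suml mulr_sumr.
apply: eq_bigr => i _; rewrite big_cat big_cons /= /update eqxx.
rewrite linearZ /= -scalerAl -scalerAr; congr (_ *: (_ * (_ * _))).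
  by apply: eq_big_seq => b b1; case: eqP => // e; rewrite -e b1 in a1.
by apply: eq_big_seq => b b2; case: eqP => // e; rewrite -e b2 in a2.
Qed.

Lemma alt_span : (forall beta : V -> I, alt (bas \o beta) = 0) ->
  forall u : V -> vec A, alt u = 0.
Proof.
(* The list [r] holds the variables whose values have not yet been replaced by members of [bas]. *)
move=> H; suff: forall (r : seq V) u,
    (forall a, a \notin r -> exists i, u a = bas i) -> alt u = 0.
  by move=> K u; apply: (K (enum V)) => a; rewrite mem_enum.
elim=> [|a r IH] u ur.
  have [beta ub] : exists beta : V -> I, forall a, u a = bas (beta a).
    exact: (@fin_all_exists _ (fun=> I) (fun a i => u a = bas i) (fun a => ur a isT)).
  rewrite -[RHS](H beta); apply: eq_bigr => s _; congr (_ *: _).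
  by apply: eq_bigr => x _; rewrite ub.
have [c ua] := bas_span (u a); rewrite (alt_update ua) big1 // => i _.
rewrite IH ?scaler0 // => b br; rewrite /update; case: eqP => [_|/eqP ba]; first by exists i.
by apply: ur; rewrite inE negb_or ba.
Qed.

End Multilinear.
End Alternation.

(** * The key polynomial *)

Section KeyWord.
Variables (F : fieldType) (q m : nat) (P : finType) (c : P -> 'I_q).

(* zvar i false and zvar i true are z_i and z'_i; xvar s p is x_(s,p); yvar s p false
   and yvar s p true are y_(s,p) and y'_(s,p).  The label forgets p in x_(s,p) only,
   so that the label-preserving permutations are those of the x_(s,_), for each s. *)
Definition var : finType := ('I_q * bool + 'I_m * P * option bool)%type.
Definition zvar i b : var := inl (i, b).
Definition xvar s p : var := inr (s, p, None).
Definition yvar s p b : var := inr (s, p, Some b).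

Definition label (a : var) : 'I_q * bool + 'I_m * option (P * bool) :=
  match a with
  | inl z => inl z
  | inr (s, p, o) => inr (s, omap (pair p) o)
  end.

(** [P] indexes the matrix units of all components together and [c] gives the component of each; [s]
    is the stage. *)
Definition triple s p := [:: yvar s p false; xvar s p; yvar s p true].
Definition core s i := flatten [seq triple s p | p <- index_enum P & c p == i].
Definition block i := zvar i false ::
  rcons (flatten [seq core s i | s <- index_enum 'I_m]) (zvar i true).
Definition word := flatten [seq block i | i <- index_enum 'I_q].

(** An arbitrary monoid law allows the same expansion for products of matrices and for counting
    letters. *)
Lemma big_flatten_map (R : Type) (idx : R) (op : Monoid.law idx) (I J : Type)
    (f : I -> seq J) (l : seq I) (g : J -> R) :
  \big[op/idx]_(a <- flatten [seq f x | x <- l]) g a =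
  \big[op/idx]_(x <- l) \big[op/idx]_(a <- f x) g a.
Proof.
by elim: l => [|x l IH]; rewrite ?big_nil //= big_cat big_cons IH.
Qed.

Lemma big_core (R : Type) (idx : R) (op : Monoid.law idx) (g : var -> R) s i :
  \big[op/idx]_(a <- core s i) g a = \big[op/idx]_(p | c p == i)
    op (g (yvar s p false)) (op (g (xvar s p)) (g (yvar s p true))).
Proof.
rewrite big_flatten_map big_filter; apply: eq_bigr => p _.
by rewrite !big_cons big_nil Monoid.mulm1.
Qed.

Lemma big_word (R : Type) (idx : R) (op : Monoid.law idx) (g : var -> R) :
  \big[op/idx]_(a <- word) g a = \big[op/idx]_(i < q)
    op (g (zvar i false)) (op
      (\big[op/idx]_(s < m) \big[op/idx]_(a <- core s i) g a)
      (g (zvar i true))).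
Proof.
rewrite big_flatten_map; apply: eq_bigr => i _.
by rewrite big_cons big_rcons big_flatten_map Monoid.mulmA.
Qed.

Lemma word_all a : a \in word.
Proof.
case: a => [[i b] | [[s p] o]]; apply/flatten_mapP.
  exists i; rewrite ?mem_index_enum // inE mem_rcons inE.
  by case: b; rewrite ?eqxx ?orbT.
exists (c p); rewrite ?mem_index_enum // inE mem_rcons inE; apply/orP; right; apply/orP; right.
apply/flatten_mapP; exists s; rewrite ?mem_index_enum //.
apply/flatten_mapP; exists p; rewrite ?mem_filter ?mem_index_enum ?eqxx //.
by case: o => [[]|]; rewrite !inE eqxx ?orbT.
Qed.

(** Every variable occurs, and the length equals the number of variables, [2q + 3m|P|]. *)
Lemma word_uniq : uniq word.
Proof.
apply: (leq_size_uniq (enum_uniq var)) => [a _|]; first exact: word_all.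
rewrite -cardE -sum1_size big_word /=.
under eq_bigr => i _.
  under eq_bigr => s _ do rewrite big_core /= sum_nat_const.
  rewrite sum_nat_const card_ord.
  over.
rewrite big_split big_split /= sum_nat_const card_ord -big_distrr /= -big_distrl /=.
rewrite !card_sum !card_prod card_option card_bool !card_ord.
have -> : (\sum_(i < q) #|fun p => c p == i|)%N = #|P|.
  rewrite -sum1_card (partition_big c predT) //=; apply: eq_bigr => i _.
  by rewrite sum1_card.
by rewrite muln1 addnCA (addnn q) -muln2 addnC mulnA.
Qed.

Lemma word_nil : (0 < q)%N -> word != [::].
Proof.
by move=> q0; have := word_all (zvar (Ordinal q0) true); case: word.
Qed.

Lemma preserves_zvar (s : {perm var}) i b : preserves label s -> s (zvar i b) = zvar i b.
Proof. by move/forallP/(_ (zvar i b)); case: (s _) => [z|[[? ?] ?]] //= /eqP [->]. Qed.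

Lemma preserves_yvar (s : {perm var}) t p b : preserves label s -> s (yvar t p b) = yvar t p b.
Proof.
by move/forallP/(_ (yvar t p b)); case: (s _) => [z|[[? ?] [?|]]] //= /eqP [] // -> -> ->.
Qed.

Lemma preserves_xvar (s : {perm var}) t p : preserves label s ->
  exists p', s (xvar t p) = xvar t p'.
Proof.
move/forallP/(_ (xvar t p)); by case: (s _) => [z|[[? p'] [?|]]] //= /eqP [] // ->; exists p'.
Qed.

(** * A substitution under which the alternated word survives *)

Section NonVanishing.
Variables (A : fdalg F) (e yl yr : P -> vec A) (E u v : 'I_q -> vec A).
Hypothesis yey : forall p p', amul (amul (yl p) (e p')) (yr p) = if p == p' then E (c p) else 0.
Hypothesis EE : forall i, amul (E i) (E i) = E i.
Hypothesis chain : \prod_(i < q) (emb (u i) * emb (E i) * emb (v i)) != 0.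

Lemma alt_word_neq0 : exists val : var -> vec A, alt label word val != 0.
Proof.
(* The idempotent [E i] is attached to [z_i] so that the triples following it, each equal to [E i],
   are absorbed one after another. *)
pose val (a : var) := match a with
  | inl (i, b) => if b then v i else amul (u i) (E i)
  | inr (s, p, None) => e p
  | inr (s, p, Some b) => if b then yr p else yl p
  end.
exists val; rewrite /alt (bigD1 1%g) /=; last by apply/forallP => a; rewrite perm1.
rewrite [X in _ + X]big1 ?addr0; last first.
  (* A nonzero monomial has every triple nonzero, and [yey] then forces [s] to fix each [x_(t,p)],
     so [s] is the identity. *)
  move=> s /andP [ps s1]; apply/eqP; rewrite scaler_eq0; apply/orP; right.
  apply: contraR s1; rewrite big_word => nz; apply/eqP/permP => a; rewrite perm1.
  case: a => [[i b]|[[t p] [b|]]]; [exact: preserves_zvar | exact: preserves_yvar |].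
  have [p' xp] := preserves_xvar t p ps; rewrite -/(xvar t p) xp; congr (inr (_, _, _)).
  have := prod_seq_neq0 nz (mem_index_enum (c p)) isT; rewrite /= mulrA => nz1.
  have {}nz1 : \prod_(s0 < m) \prod_(a <- core s0 (c p)) emb (val (s a)) != 0.
    by apply: contraNneq nz1 => ->; rewrite mulr0 mul0r.
  have := prod_seq_neq0 nz1 (mem_index_enum t) isT; rewrite big_core => nz2.
  have := prod_seq_neq0 nz2 (mem_index_enum p) (eqxx _).
  rewrite !(preserves_yvar _ _ _ ps) xp /= mulrA -!embM yey.
  by case: (p =P p') => [-> //|_]; rewrite linear0 eqxx.
rewrite odd_perm1 scale1r big_word /=; apply: contra chain => /eqP <-.
apply/eqP; apply: eq_bigr => i _; rewrite !perm1 /= embM mulrA; congr (_ * _).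
rewrite -mulrA prod_absorb // => s _; rewrite big_core prod_absorb // => p /eqP <-.
by rewrite !perm1 /= [X in _ * X]mulrA -!embM yey eqxx EE.
Qed.

End NonVanishing.

(** * Consequences of a nonzero value in the second algebra *)

Section Vanishing.
Variables (B : fdalg F) (J : subsp B) (r : nat) (T : 'I_r -> subsp B).
Hypothesis two : (2%:R : F) != 0.
Hypothesis Jid : is_ideal J.
Hypothesis Jnil : forall (x : vec B) (xs : seq (vec B)), size xs = m.-1 ->
  (x <= J)%MS -> (forall y, y \in xs -> (y <= J)%MS) -> prodl x xs = 0.
Hypothesis m_gt0 : (0 < m)%N.
Hypothesis T_orth : forall i j x y, i != j -> (x <= T i)%MS -> (y <= T j)%MS -> amul x y = 0.
Hypothesis BTJ : forall x : vec B, exists (t : 'I_r -> 'rV[F]_(fdim B)) (z : vec B),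
  [/\ x = \sum_i t i + z, forall i, (t i <= T i)%MS & (z <= J)%MS].

(** A spanning family adapted to the decomposition: bases of the [T j] on the left, a basis of [J]
    on the right. *)
Let idx : finType := ({j : 'I_r & 'I_(\rank (T j))} + 'I_(\rank J))%type.
Let bas (b : idx) : vec B := match b with
  | inl t => row (tagged t) (row_base (T (tag t)))
  | inr k => row k (row_base J)
  end.

Let bas_span (x : vec B) : exists a : idx -> F, x = \sum_i a i *: bas i.
Proof.
have rowspan (M : subsp B) (y : vec B) : (y <= M)%MS ->
    exists a : 'I_(\rank M) -> F, y = \sum_k a k *: row k (row_base M).
  move=> yM; have /submxP [D ->] : (y <= row_base M)%MS by rewrite eq_row_base.
  by exists (D 0); apply: mulmx_sum_row.
have [t [z [-> tT zJ]]] := BTJ x; have [a ->] := rowspan _ _ zJ.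
have [b tb] := fin_all_exists (fun i => rowspan _ _ (tT i)).
exists (fun i : idx => match i with inl j => b (tag j) (tagged j) | inr k => a k end).
rewrite big_sumType /=; congr (_ + _).
under eq_bigr => i _ do rewrite tb.
exact: (sig_big_dep predT (fun=> predT) (fun i k => b i k *: row k (row_base (T i)))).
Qed.

(** [kappa p] is the component of B holding the value put at [x_(t,p)] in a surviving monomial, at a
    stage [t] free of radical values. Alternation makes these values distinct, which bounds the
    fibres; orthogonality of the [T j] makes [kappa] constant on each component of A. *)
Lemma alt_word_basis_neq0 (beta : var -> idx) : alt label word (bas \o beta) != 0 ->
  exists kappa : P -> 'I_r, (forall p p', c p = c p' -> kappa p = kappa p') /\
    forall j, (#|[pred p | kappa p == j]| <= \rank (T j))%N.
Proof.
move=> nz.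
have beta_inj s p p' : beta (xvar s p) = beta (xvar s p') -> p = p'.
  move=> bb; apply/eqP; apply: contraNT nz => pp'; apply/eqP.
  apply: (@alt_eq0 _ _ _ label word _ _ (xvar s p) (xvar s p') two) => //.
    by apply: contraNneq pp' => - [->].
  exact: (congr1 bas bb).
have [s ps nzs] : exists2 s : {perm var}, preserves label s &
    \prod_(a <- word) emb (bas (beta (s a))) != 0.
  apply/exists_inP; apply: contraR nz; rewrite negb_exists => /forallP z.
  rewrite /alt big1 // => s ps; apply/eqP; rewrite scaler_eq0.
  by have := z s; rewrite ps negbK => ->; rewrite orbT.
pose isJ (a : var) := if beta (s a) is inr _ then true else false.
have cntJ : (count isJ word < m)%N.
  rewrite ltnNge; apply: contra nzs => mc.
  (* With [m] radical letters the monomial becomes a product of a head and [m.-1] further elements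
     of [J], which is zero. *)
  have : (m.-1 < count (fun x => x <= J)%MS [seq bas (beta (s a)) | a <- word])%N.
    rewrite prednK // count_map; apply: leq_trans mc _; apply: sub_count => a.
    rewrite /isJ /= /bas; case: (beta _) => // k _.
    by apply: submx_trans (row_sub _ _) _; rewrite eq_row_base.
  case/(prod_ideal_collect Jid) => x [xs [sz xJ xsJ]].
  by rewrite big_map (Jnil sz xJ xsJ) linear0 => ->.
(* Pigeonhole: a radical letter in each of the [m] stages would give [m] distinct ones. *)
have [t tss] : exists t : 'I_m, forall p o, ~~ isJ (inr (t, p, o)).
  suff /existsP [t /forallP tP] :
      [exists t : 'I_m, forall po : P * option bool, ~~ isJ (inr (t, po.1, po.2))].
    by exists t => p o; apply: (tP (p, o)).
  apply: contraLR cntJ; rewrite negb_exists -leqNgt => /forallP no.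
  pose bad (t : 'I_m) a := isJ a && (if a is inr (t', _, _) then t' == t else false).
  have [f fP] : exists f : 'I_m -> var, forall t, bad t (f t).
    apply: (@fin_all_exists _ (fun=> var) (fun t a => bad t a)) => t.
    have := no t; rewrite negb_forall => /existsP [[p o]]; rewrite negbK => J1.
    by exists (inr (t, p, o)); rewrite /bad J1 eqxx.
  have f_inj : injective f.
    move=> t1 t2 ft; have := fP t1; have := fP t2; rewrite /bad ft.
    by case: (f t2) => [z|[[t' ?] ?]]; rewrite ?andbF // => /andP [_ /eqP <-] /andP [_ /eqP].
  rewrite -[X in (X <= _)%N](card_ord m) -(card_image f_inj) cardE -size_filter.
  apply: uniq_leq_size; first exact: enum_uniq.
  move=> a; rewrite mem_enum => /imageP [t _ ->]; rewrite mem_filter word_all andbT.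
  by case/andP: (fP t).
have comp (a : var) : ~~ isJ a -> exists j : {j : 'I_r & 'I_(\rank (T j))}, beta (s a) = inl j.
  by rewrite /isJ; case: (beta _) => // j; exists j.
have sx p : exists p', s (xvar t p) = xvar t p' by apply: preserves_xvar.
have [j0 bj0] : exists j0 : P -> {j : 'I_r & 'I_(\rank (T j))},
    forall p, beta (s (xvar t p)) = inl (j0 p).
  apply: (@fin_all_exists _ (fun=> {j : 'I_r & 'I_(\rank (T j))})
    (fun p j => beta (s (xvar t p)) = inl j)) => p.
  exact/comp/tss.
have j0_inj : injective j0.
  move=> p1 p2 jj; have [p1' e1] := sx p1; have [p2' e2] := sx p2.
  have pp : p1' = p2' by apply: (beta_inj t); rewrite -e1 -e2 !bj0 jj.
  by have : xvar t p1 = xvar t p2; [apply: (@perm_inj _ s); rewrite e1 e2 pp | case].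
exists (fun p => tag (j0 p)); split; last first.
  move=> j; rewrite -[X in (_ <= X)%N]card_ord.
  have h (p : {p | tag (j0 p) == j}) : exists k : 'I_(\rank (T j)), j0 (val p) = Tagged _ k.
    case: p => p /= /eqP; case: (j0 p) => i k /= ij; move: k; rewrite ij => k; by exists k.
  have [k kP] := fin_all_exists h.
  rewrite -[X in (X <= _)%N](card_sig (fun p => tag (j0 p) == j)).
  apply: (@leq_card _ _ k) => p1 p2 k12; apply/val_inj/j0_inj; by rewrite !kP k12.
move=> p p' cpp'.
pose kk (a : var) : option 'I_r := if beta (s a) is inl j then Some (tag j) else None.
suff : kk (xvar t p) = kk (xvar t p') by rewrite /kk !bj0 => - [].
have incore p0 : c p0 = c p -> xvar t p0 \in core t (c p).
  move=> cp; apply/flatten_mapP; exists p0; last by rewrite !inE eqxx ?orbT.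
  by rewrite mem_filter cp eqxx mem_index_enum.
(* A factor of the surviving monomial; all its letters have semisimple values, and neighbours from
   different [T j] would annihilate each other. *)
have nzc : \prod_(a <- core t (c p)) emb (bas (beta (s a))) != 0.
  rewrite big_word in nzs.
  have := prod_seq_neq0 nzs (mem_index_enum (c p)) isT; rewrite /= mulrA => nz1.
  have {}nz1 : \prod_(s0 < m) \prod_(a <- core s0 (c p)) emb (bas (beta (s a))) != 0.
    by apply: contraNneq nz1 => ->; rewrite mulr0 mul0r.
  exact: prod_seq_neq0 nz1 (mem_index_enum t) isT.
apply: (prod_neq0_const _ nzc) => [a b ac bc||]; try by apply: incore.
have incoreP a0 : a0 \in core t (c p) -> exists p0 o, a0 = inr (t, p0, o).
  case/flatten_mapP => p0 _; rewrite !inE => /or3P [] /eqP ->; by do 2!eexists.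
have [pa [oa ea]] := incoreP _ ac; have [pb [ob eb]] := incoreP _ bc.
have [ja eja] : exists j, beta (s a) = inl j by apply: comp; rewrite ea; apply: tss.
have [jb ejb] : exists j, beta (s b) = inl j by apply: comp; rewrite eb; apply: tss.
rewrite /kk eja ejb -embM emb_eq0 => nzab; congr Some; apply/eqP; apply: contraNT nzab => jj.
apply/eqP; apply: (T_orth jj); rewrite /= -[T _]/(T (tag _)).
  by apply: submx_trans (row_sub _ _) _; rewrite eq_row_base.
by apply: submx_trans (row_sub _ _) _; rewrite eq_row_base.
Qed.

Lemma alt_word_basis : (exists u : var -> vec B, alt label word u != 0) ->
  exists kappa : P -> 'I_r, (forall p p', c p = c p' -> kappa p = kappa p') /\
    forall j, (#|[pred p | kappa p == j]| <= \rank (T j))%N.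
Proof.
case=> u nz; apply: NNPP => nk; case/eqP: nz; move: u.
apply: (alt_span word_uniq word_all bas_span) => beta.
by apply/eqP; apply: contraT => nz; case: nk; apply: alt_word_basis_neq0 nz.
Qed.

End Vanishing.
End KeyWord.

(** * Full algebras *)

Section FullAlgebras.
Variables (F : closedFieldType) (A : fdalg F).
Implicit Types (S J : subsp A) (x a b : vec A).

(** A form of [S = S E S] usable inside a product: a factor from [S] can be replaced by some [a E b]
    without making the product vanish. *)
Definition factors_through S (E : vec A) := forall (C D : 'M[F]_((fdim A).+1)) x,
  (x <= S)%MS -> C * emb x * D != 0 ->
  exists a b, C * (emb a * emb E * emb b) * D != 0.

(** If [e p] is the matrix unit at position [(k,l)], then [yl p], [yr p] and [E] are those at
    [(0,k)], [(l,0)] and [(0,0)]. *)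
Lemma simple_units S : simple_subalg S ->
  exists d : ('I_(\rank S) -> vec A) * ('I_(\rank S) -> vec A) * ('I_(\rank S) -> vec A) * vec A,
  let: (e, yl, yr, E) := d in
  [/\ forall p p', amul (amul (yl p) (e p')) (yr p) = if p == p' then E else 0,
      amul E E = E,
      (E <= S)%MS, forall p, [/\ (e p <= S)%MS, (yl p <= S)%MS & (yr p <= S)%MS]
    & factors_through S E].
Proof.
move=> /wedderburn [n [g [fg gS gM]]].
have rS : \rank S = #|{: 'I_n.+1 * 'I_n.+1}|.
  by rewrite card_prod !card_ord -(eqP fg) (eqmxP gS).
pose ix (p : 'I_(\rank S)) : 'I_n.+1 * 'I_n.+1 := enum_val (cast_ord rS p).
have ix_inj : injective ix by move=> p p' /enum_val_inj /cast_ord_inj.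
pose mu k l : vec A := mxvec (delta_mx k l) *m g.
have muM i j k l : amul (mu i j) (mu k l) = if j == k then mu i l else 0.
  rewrite gM mul_delta_mx_cond /mu; case: eqP => // _.
  by rewrite mulr0n linear0 mul0mx.
have muS k l : (mu k l <= S)%MS by rewrite -(eqmxP gS) submxMl.
exists (fun p => mu (ix p).1 (ix p).2, fun p => mu ord0 (ix p).1,
        fun p => mu (ix p).2 ord0, mu ord0 ord0); split=> // [p p'|C D x xS nz].
- rewrite muM; have [->|pp'] := eqVneq p p'; first by rewrite eqxx muM eqxx.
  case: eqP => e1; last by rewrite amul0r.
  rewrite muM; case: eqP => // e2; case/eqP: pp'; apply: ix_inj.
  by rewrite [ix p]surjective_pairing [ix p']surjective_pairing e1 e2.
suff /existsP [k /existsP [l kl]] :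
    [exists k, exists l, C * (emb (mu k ord0) * emb (mu ord0 ord0) * emb (mu ord0 l)) * D != 0].
  by exists (mu k ord0), (mu ord0 l).
apply: contraR nz; rewrite negb_exists => /forallP z.
have /submxP [X ->] : (x <= g)%MS by rewrite (eqmxP gS).
rewrite -[X]vec_mxK [vec_mx X]matrix_sum_delta !linear_sum mulmx_suml linear_sum.
rewrite mulr_sumr mulr_suml big1 // => k _.
rewrite linear_sum mulmx_suml linear_sum mulr_sumr mulr_suml big1 // => l _.
rewrite !linearZ -scalemxAl linearZ -scalerAr -scalerAl.
have := z k; rewrite negb_exists => /forallP /(_ l).
by rewrite negbK -!embM !muM !eqxx => /eqP ->; rewrite scaler0.
Qed.

(** Going from left to right, each simple factor [a] becomes [a' E b'] and the radical factor after
    it is merged into [b']; [C] accumulates the part already treated. *)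
Lemma chain_prod_units J Ss (E : nat -> vec A) x (C : 'M[F]_((fdim A).+1)) :
  (forall i, (i < size Ss)%N -> factors_through (nth 0 Ss i) (E i)) ->
  chain_prod J Ss x -> C * emb x != 0 ->
  exists u v : nat -> vec A,
    C * \prod_(i < size Ss) (emb (u i) * emb (E i) * emb (v i)) != 0.
Proof.
elim: Ss E x C => [|S0 [|S1 Ss] IH] E x C fE //.
  move=> /= xS nz; have [|a [b ab]] := fE 0%N isT C 1 x xS; first by rewrite mulr1.
  by exists (fun=> a), (fun=> b); rewrite big_ord1; move: ab; rewrite mulr1.
case=> [a [j [y [aS jJ ch ->]]]]; rewrite !embM !mulrA -(mulrA (C * _)) => nz.
have [a' [b' nz']] := fE 0%N isT _ _ _ aS nz.
have [|||u [v nuv]] := IH (E \o succn) y (C * (emb a' * emb (E 0%N) * emb (amul b' j))).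
- by move=> i ilt; apply: (fE i.+1).
- exact: ch.
- by rewrite embM; move: nz'; rewrite !mulrA.
exists (fun n => if n is n'.+1 then u n' else a').
exists (fun n => if n is n'.+1 then v n' else amul b' j).
by rewrite big_ord_recl mulrA.
Qed.

End FullAlgebras.

(** The alternated word is not an identity of A by fullness, hence not one of B, and a nonzero value
    in B yields the packing. *)
Lemma full_dominated (F : closedFieldType) (A B : fdalg F) (J : subsp A) (Ss : seq (subsp A))
    (J' : subsp B) (Ss' : seq (subsp B)) :
  (2%:R : F) != 0 -> WMdec J Ss -> (Ss = [::] \/ exists x, chain_prod J Ss x /\ x != 0) ->
  WMdec J' Ss' -> (forall p : ncpoly F, is_identity B p -> is_identity A p) ->
  dominated (fun i : 'I_(size Ss) => \rank (nth 0 Ss i))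
            (fun i : 'I_(size Ss') => \rank (nth 0 Ss' i)).
Proof.
move=> two dec fullA dec' BA; set q := size Ss.
pose S (i : 'I_q) : subsp A := nth 0 Ss i.
have [q0|q_gt0] := posnP q.
  have no (i : 'I_q) : False by case: i => i; rewrite q0.
  by exists (fun i => False_rect _ (no i)) => j; rewrite big1 // => i _; case: (no i).
have [x [chx x0]] : exists x, chain_prod J Ss x /\ x != 0.
  by case: fullA => // Ss0; move: q_gt0; rewrite /q Ss0.
have [dat datP] := fin_all_exists (fun i => simple_units (WM_simple dec i)).
pose P := {i : 'I_q & 'I_(\rank (S i))}.
pose c (p : P) : 'I_q := tag p.
pose e (p : P) : vec A := (dat (tag p)).1.1.1 (tagged p).
pose yl (p : P) : vec A := (dat (tag p)).1.1.2 (tagged p).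
pose yr (p : P) : vec A := (dat (tag p)).1.2 (tagged p).
pose E i : vec A := (dat i).2.
have EE i : amul (E i) (E i) = E i.
  by have := datP i; rewrite /E; case: (dat i) => [[[? ?] ?] ?] [].
have ft i : factors_through (S i) (E i).
  by have := datP i; rewrite /E; case: (dat i) => [[[? ?] ?] ?] [].
have mem p : [/\ (e p <= S (tag p))%MS, (yl p <= S (tag p))%MS & (yr p <= S (tag p))%MS].
  case: p => i k; have := datP i; rewrite /e /yl /yr /=.
  by case: (dat i) => [[[? ?] ?] ?] [_ _ _ /(_ k)].
have yey p p' : amul (amul (yl p) (e p')) (yr p) = if p == p' then E (c p) else 0.
  have [pp|pp] := eqVneq (tag p) (tag p'); last first.
    have [_ ylS _] := mem p; have [eS _ _] := mem p'.
    rewrite (WM_orth dec pp ylS eS) amul0r.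
    by case: eqP => // ppe; rewrite ppe eqxx in pp.
  case: p p' pp => i k [i' k'] /= ii; case: i' / ii k' => k'.
  rewrite eq_Tagged /=; have := datP i; rewrite /e /yl /yr /E /=.
  by case: (dat i) => [[[? ?] ?] ?] [-> _ _ _ _].
(* Extends [E] by 0 to all natural numbers, the index type over which the chain is treated. *)
pose En n : vec A := if insub n is Some i then E i else 0.
have [||u [v nuv]] := @chain_prod_units F A J Ss En x 1 _ chx.
- by move=> i ilt; rewrite /En insubT; apply: (ft (Ordinal ilt)).
- by rewrite mul1r emb_eq0.
case: (dec') => [[J'id [k J'nil] _] _ _ _ _].
(* Nilpotency is stated for a head followed by [k] elements, hence for [k.+1] factors. *)
pose m := k.+1.
have chain : \prod_(i < q) (emb (u i) * emb (E i) * emb (v i)) != 0.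
  rewrite mul1r in nuv; apply: contra nuv => /eqP <-; apply/eqP.
  by apply: eq_bigr => i _; rewrite /En valK.
have [val valP] := alt_word_neq0 m yey EE chain.
have [pol polP] := @alt_ncpoly F _ _ (@label q m P) (word m c) (word_nil m c q_gt0).
have [w nzw] : exists w : var q m P -> vec B, alt (@label q m P) (word m c) w != 0.
  apply: NNPP => no; case/eqP: valP; apply: (polP A).1; apply: BA; apply/polP => w.
  by apply/eqP; apply: contraT => nz; case: no; exists w.
have [kappa [kc kT]] := @alt_word_basis F q m P c B J' (size Ss')
  (fun i => nth 0 Ss' i) two J'id J'nil isT (WM_orth dec') (WM_decomp dec') (ex_intro _ w nzw).
have r_gt0 i : (0 < \rank (S i))%N by apply: simple_rank_gt0; apply: WM_simple dec i.
(* [kappa] is constant on the units of a component, so it may be read off at the first one. *)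
pose phi (i : 'I_q) := kappa (Tagged (fun i => 'I_(\rank (S i))) (Ordinal (r_gt0 i))).
exists phi => j; apply: leq_trans (kT j).
under eq_bigr => i _ do rewrite -[\rank _]card_ord -sum1_card.
rewrite (sig_big_dep (fun i => phi i == j) (fun=> predT) (fun _ _ => 1%N)) sum1_card.
apply/subset_leq_card/subsetP => p; rewrite !inE => /andP [/eqP <- _].
by apply/eqP/kc.
Qed.

(** * Isomorphisms of semisimple subalgebras *)

Section DirectSums.
Variables (F : fieldType) (A : fdalg F) (I : eqType) (S : I -> subsp A).
Hypothesis Salg : forall i, is_subalg (S i).
Hypothesis orth : forall i j x y, i != j -> (x <= S i)%MS -> (y <= S j)%MS -> amul x y = 0.

Lemma sum_orth i (r : seq I) x y : i \notin r -> (x <= S i)%MS ->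
  (y <= (\sum_(j <- r) S j)%MS)%MS -> amul x y = 0 /\ amul y x = 0.
Proof.
move=> + xS; elim: r y => [|j r IH] y.
  by rewrite big_nil submx0 => _ /eqP ->; rewrite amul0r amulr0.
rewrite inE negb_or big_cons => /andP [ij ir] /sub_addsmxP [[u v] /= ->].
have [e1 e2] := IH _ ir (submxMl v _).
rewrite amulDl amulDr e1 e2 !addr0 (orth ij) ?submxMl //.
by rewrite (@orth j i) ?submxMl // eq_sym.
Qed.

Lemma sum_subalg (r : seq I) : uniq r -> is_subalg (\sum_(i <- r) S i)%MS.
Proof.
elim: r => [_|i r IH /= /andP [ir ur]] x y.
  by rewrite big_nil submx0 => /eqP -> _; rewrite amul0r sub0mx.
rewrite big_cons => /sub_addsmxP [[u v] /= ->] /sub_addsmxP [[u' v'] /= ->].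
have [e1 _] := sum_orth ir (submxMl u (S i)) (submxMl v' (\sum_(i <- r) S i)%MS).
have [_ e2] := sum_orth ir (submxMl u' (S i)) (submxMl v (\sum_(i <- r) S i)%MS).
rewrite !amulDl !amulDr e1 e2 addr0 add0r addmx_sub_adds //.
  by apply: Salg; apply: submxMl.
by apply: IH => //; apply: submxMl.
Qed.

End DirectSums.

Section Isomorphisms.
Variables (F : fieldType) (A B : fdalg F).

(** The two maps are glued along the projections of the direct sum; mixed products vanish on both
    sides. *)
Lemma iso_adds (S S' : subsp A) (T T' : subsp B) :
  is_subalg S -> is_subalg S' -> (S :&: S' = 0)%MS -> (T :&: T' = 0)%MS ->
  (forall x y, (x <= S)%MS -> (y <= S')%MS -> amul x y = 0 /\ amul y x = 0) ->
  (forall x y, (x <= T)%MS -> (y <= T')%MS -> amul x y = 0 /\ amul y x = 0) ->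
  subalg_iso S T -> subalg_iso S' T' -> subalg_iso (S + S')%MS (T + T')%MS.
Proof.
move=> Sal Sal' SS' TT' So To [f [/eqmxP fS fr fM]] [f' [/eqmxP fS' fr' fM']].
pose g := proj_mx S S' *m f + proj_mx S' S *m f'.
have S'S : (S' :&: S = 0)%MS by rewrite capmxC.
have gS k (x : 'M_(k, _)) : (x <= S)%MS -> x *m g = x *m f.
  by move=> xS; rewrite mulmxDr (mulmxA x (proj_mx S S'))
    (mulmxA x (proj_mx S' S)) (proj_mx_id SS') // (proj_mx_0 S'S) // mul0mx addr0.
have gS' k (x : 'M_(k, _)) : (x <= S')%MS -> x *m g = x *m f'.
  by move=> xS; rewrite mulmxDr (mulmxA x (proj_mx S S'))
    (mulmxA x (proj_mx S' S)) (proj_mx_0 SS') // (proj_mx_id S'S) // mul0mx add0r.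
have gSS' : ((S + S')%MS *m g :=: T + T')%MS.
  apply: eqmx_trans (addsmxMr _ _ _) _; rewrite gS // gS' //.
  exact: adds_eqmx.
have rk0 (C : fdalg F) (U V : subsp C) : (U :&: V = 0)%MS ->
    \rank (U + V)%MS = (\rank U + \rank V)%N.
  by move=> UV; rewrite -mxrank_sum_cap UV mxrank0 addn0.
exists g; split; first exact/eqmxP.
  by rewrite gSS' !rk0 // -fr -fr' fS fS'.
move=> _ _ /sub_addsmxP [[u u'] /= ->] /sub_addsmxP [[v v'] /= ->].
have [uS u'S] := (submxMl u S, submxMl u' S'); have [vS v'S] := (submxMl v S, submxMl v' S').
have fT x : (x <= S)%MS -> (x *m f <= T)%MS by move=> xS; rewrite -fS submxMr.
have fT' x : (x <= S')%MS -> (x *m f' <= T')%MS by move=> xS; rewrite -fS' submxMr.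
rewrite !amulDl !amulDr (So _ _ uS v'S).1 (So _ _ vS u'S).2 addr0 add0r.
rewrite !(mulmxDl _ _ g) (gS _ _ (Sal _ _ uS vS)) (gS' _ _ (Sal' _ _ u'S v'S)).
rewrite !(gS _ _ uS) !(gS _ _ vS) !(gS' _ _ u'S) !(gS' _ _ v'S) !amulDl !amulDr fM // fM' //.
by rewrite (To _ _ (fT _ _ uS) (fT' _ _ v'S)).1 (To _ _ (fT _ _ vS) (fT' _ _ u'S)).2 addr0 add0r.
Qed.

Lemma iso_sum (I : eqType) (S : I -> subsp A) (T : I -> subsp B) (r : seq I) : uniq r ->
  (forall i, is_subalg (S i)) ->
  (forall i j x y, i != j -> (x <= S i)%MS -> (y <= S j)%MS -> amul x y = 0) ->
  (forall i j x y, i != j -> (x <= T i)%MS -> (y <= T j)%MS -> amul x y = 0) ->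
  (forall i s, i \notin s -> (S i :&: (\sum_(j <- s) S j)%MS = 0)%MS) ->
  (forall i s, i \notin s -> (T i :&: (\sum_(j <- s) T j)%MS = 0)%MS) ->
  (forall i, subalg_iso (S i) (T i)) ->
  subalg_iso (\sum_(i <- r) S i)%MS (\sum_(i <- r) T i)%MS.
Proof.
move=> + Sal So To Scap Tcap ST; elim: r => [_|i r IH /= /andP [ir ur]].
  rewrite !big_nil; exists 0; split=> [||x y].
  - by apply/eqmxP; rewrite mulmx0; apply: eqmx0.
  - by rewrite mulmx0 !mxrank0.
  - by rewrite !mulmx0 amul0r.
rewrite !big_cons; apply: iso_adds => //.
- exact: sum_subalg.
- exact: Scap.
- exact: Tcap.
- by move=> x y; apply: sum_orth.
- by move=> x y; apply: sum_orth.
- exact: IH.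
Qed.

Lemma WM_cap J Ss (i : 'I_(size Ss)) (s : seq 'I_(size Ss)) : WMdec (A := A) J Ss -> i \notin s ->
  (nth 0 Ss i :&: (\sum_(j <- s) nth 0 Ss j)%MS = 0)%MS.
Proof.
move=> dec is_; pose S (j : 'I_(size Ss)) : subsp A := nth 0 Ss j.
(* Additivity of ranks modulo [J] gives independence of the components; the list [s], which may
   repeat indices, is then compared with the set of all [j != i]. *)
have rkK (K : pred 'I_(size Ss)) : (\sum_(j | K j) \rank (S j) <= \rank (\sum_(j | K j) S j)%MS)%N.
  by rewrite -(leq_add2r (\rank J)) -(WM_rank dec) mxrank_adds_leqif.
have cap0 : (S i :&: (\sum_(j | j != i) S j)%MS = 0)%MS.
  apply/eqP; rewrite -mxrank_eq0 -leqn0.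
  rewrite -(leq_add2l (\rank (S i + (\sum_(j | j != i) S j))%MS)) mxrank_sum_cap addn0.
  have -> : (S i + (\sum_(j | j != i) S j))%MS = (\sum_j S j)%MS by rewrite [RHS](bigD1 i).
  apply: leq_trans (rkK predT); rewrite [X in (_ <= X)%N](bigD1 i) //= leq_add2l.
  exact: mxrank_sum_leq.
suff sub : ((\sum_(j <- s) S j)%MS <= (\sum_(j | j != i) S j)%MS)%MS.
  by apply/eqP; rewrite -submx0; have := capmxS (submx_refl (S i)) sub; rewrite cap0.
elim: s is_ => [|j s IH].
  by rewrite big_nil sub0mx.
rewrite inE negb_or big_cons addsmx_sub => /andP [ij js]; rewrite IH // andbT.
by rewrite (sumsmx_sup j) // eq_sym.
Qed.

End Isomorphisms.

(** Both are matrix algebras, and the rank, being the square of the matrix size, determines that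
    size. *)
Lemma simple_iso (F : closedFieldType) (A B : fdalg F) (S : subsp A) (T : subsp B) :
  simple_subalg S -> simple_subalg T -> \rank S = \rank T -> subalg_iso S T.
Proof.
move=> /wedderburn [n [g [fg /eqmxP gS gM]]] /wedderburn [n' [h [fh /eqmxP hT hM]]] rST.
have nn' : n = n'.
  have : (n.+1 ^ 2 == n'.+1 ^ 2)%N by rewrite -!mulnn -(eqP fg) -(eqP fh) gS hT rST.
  by rewrite eqn_sqr => /eqP [].
case: n' / nn' h fh hT hM => h fh hT hM.
have gf k (X : 'M_(k, _)) : X *m g *m (pinvmx g *m h) = X *m h.
  by rewrite -mulmxA (mulmxA g) mulmxVp // mul1mx.
have Sf : (S *m (pinvmx g *m h) :=: T)%MS.
  apply: eqmx_trans (eqmxMr _ (eqmx_sym gS)) _.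
  by have := gf _ 1%:M; rewrite !mul1mx => ->.
exists (pinvmx g *m h); split; [exact/eqmxP | by rewrite Sf |].
move=> x y; rewrite -!gS => /submxP [X ->] /submxP [Y ->].
by rewrite -[X]vec_mxK -[Y]vec_mxK gM !gf hM.
Qed.

Theorem theorem1p2 (F : closedFieldType) (charF0 : [pchar F] =i pred0)
  (A B : fdalg F) (fullA : full A) (fullB : full B)
  (PIeq : forall p : ncpoly F, is_identity A p <-> is_identity B p)
  (JA : subsp A) (SsA : seq (subsp A)) (JB : subsp B) (SsB : seq (subsp B))
  (decA : WMdec JA SsA) (decB : WMdec JB SsB) :
  subalg_iso (ss_part SsA) (ss_part SsB).
Proof.
have two : (2%:R : F) != 0 by have := charF0 2; rewrite inE /= => /negbT.
case: fullA fullB => [JA' [SsA' [decA' chA]]] [JB' [SsB' [decB' chB]]].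
(* The given decomposition of A is compared first with the one witnessing fullness, and that one
   with the given decomposition of B. *)
have AB : dominated (fun i : 'I_(size SsA) => \rank (nth 0 SsA i))
                    (fun i : 'I_(size SsB) => \rank (nth 0 SsB i)).
  apply: dominated_trans (WM_dominated decA decA') _.
  by apply: (full_dominated two decA' chA decB) => p /PIeq.
have BA : dominated (fun i : 'I_(size SsB) => \rank (nth 0 SsB i))
                    (fun i : 'I_(size SsA) => \rank (nth 0 SsA i)).
  apply: dominated_trans (WM_dominated decB decB') _.
  by apply: (full_dominated two decB' chB decA) => p /PIeq.
have [||phi phi_bij rk] := dominated_antisym _ _ AB BA.
- by move=> i; apply: simple_rank_gt0; apply: WM_simple decA i.
- by move=> i; apply: simple_rank_gt0; apply: WM_simple decB i.
have phi_inj := bij_inj phi_bij.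
(* Reindexing by [phi] pairs components of equal dimension, so that the isomorphism is built summand
   by summand. *)
have -> : ss_part SsB = (\sum_(i < size SsA) nth 0 SsB (phi i))%MS.
  by rewrite /ss_part WM_sumE (reindex phi) //; apply: onW_bij.
rewrite /ss_part WM_sumE; apply: iso_sum.
- exact: index_enum_uniq.
- by move=> i; case: (WM_simple decA i).
- by move=> i j x y; apply: (WM_orth decA).
- by move=> i j x y ij; apply: (WM_orth decB); rewrite (inj_eq phi_inj).
- by move=> i s; apply: (WM_cap decA).
- move=> i s is_; rewrite -(big_map phi predT (fun j => nth 0 SsB (nat_of_ord j))).
  by apply: (WM_cap decB); rewrite mem_map.
- by move=> i; apply: simple_iso (rk i); [apply: WM_simple decA i | apply: WM_simple decB (phi i)].
Qed.
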